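(* For all real numbers $a,b>0$, writing $H=H(a,b)$, $G=G(a,b)$, $N_i=N_i(a,b)$ for $i=1,2,3$, $A=A(a,b)$, $S=S(a,b)$, the following hold: $$G\le \frac{S+3G}{4}\le N_1\le \frac{S+8N_1}{9}\le N_3\le N_2\le \frac{A+N_1}{2}\le \frac{S+2N_1}{3}\le T\le A$$ for each of the two choices $T=\frac{S+4N_2}{5}$ and $T=\frac{S+3N_3}{4}$; and $$G\le \frac{S+2H}{3}\le N_1\le \frac{S+H}{2}\le N_2.$$
   Context: For $a,b>0$ define the means $H(a,b)=\frac{2ab}{a+b}$, $G(a,b)=\sqrt{ab}$, $N_1(a,b)=\left(\frac{\sqrt a+\sqrt b}{2}\right)^2$, $N_2(a,b)=\left(\frac{\sqrt a+\sqrt b}{2}\right)\sqrt{\frac{a+b}{2}}$, $N_3(a,b)=\frac{a+\sqrt{ab}+b}{3}$, $A(a,b)=\frac{a+b}{2}$, $S(a,b)=\sqrt{\frac{a^2+b^2}{2}}$. *)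

(* Defs.v *)
From Stdlib Require Import Reals.
Open Scope R_scope.

(* The means are intended for a, b > 0; outside that range they take whatever
   value the total functions [sqrt] and [/] give. *)
Definition meanH (a b : R) : R := 2 * a * b / (a + b).
Definition meanG (a b : R) : R := sqrt (a * b).
Definition meanN1 (a b : R) : R := ((sqrt a + sqrt b) / 2) ^ 2.
Definition meanN2 (a b : R) : R := (sqrt a + sqrt b) / 2 * sqrt ((a + b) / 2).
Definition meanN3 (a b : R) : R := (a + sqrt (a * b) + b) / 3.
Definition meanA (a b : R) : R := (a + b) / 2.
Definition meanS (a b : R) : R := sqrt ((a ^ 2 + b ^ 2) / 2).

(* Main.v *)
Require Import Defs.
From Stdlib Require Import Reals Lra Psatz.
Open Scope R_scope.

(** Every mean in the chain is a function of [A] and [G]: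
    [S ^ 2 = 2 A ^ 2 - G ^ 2], [A H = G ^ 2], [N1 = (A + G) / 2],
    [N3 = (2 A + G) / 3] and [N2 ^ 2 = A (A + G) / 2], with [0 < G <= A].
    After clearing [A] from denominators, each comparison involving [S] bounds
    [S] or [A S] above or below by a polynomial in [A], [G] and [U = N2].
    Squaring turns it into a homogeneous polynomial inequality, in which
    [A = G = U] (the case [a = b]) is a root; removing that factor, often
    with multiplicity two or three, leaves a cofactor of visible sign. The one
    exception is [(S + H) / 2 <= N2], where [U] is first replaced by [A].

    Several comparisons are the same bound on [S]: [S <= 2 A - G] says each of
    [(S + 3 G) / 4 <= N1], [(S + 8 N1) / 9 <= N3],
    [(S + 2 N1) / 3 <= (S + 3 N3) / 4] and [(S + 3 N3) / 4 <= A], while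
    [A <= S] gives [G <= S] and [N1 <= S]. Only [N3 <= N2 <= (A + N1) / 2] do
    not involve [S]; the second is the arithmetic-geometric inequality for [A]
    and [N1], whose geometric mean is [N2]. *)

Lemma le_of_sqr_le x y : 0 <= y -> x ^ 2 <= y ^ 2 -> x <= y.
Proof. intros Hy Hxy. apply Rsqr_incr_0_var; [unfold Rsqr; lra | exact Hy]. Qed.

(** * Bounds on the root-square mean in terms of A and G *)

(** The difference of squares is [2 (A - G) ^ 2]. *)
Lemma rootsq_le A G S : 0 < G <= A -> S ^ 2 = 2 * A ^ 2 - G ^ 2 ->
  S <= 2 * A - G.
Proof. intros HG HS. apply le_of_sqr_le; [lra|]. rewrite HS. nra. Qed.

Lemma arith_le_rootsq A G S : 0 < G <= A -> 0 <= S ->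
  S ^ 2 = 2 * A ^ 2 - G ^ 2 -> A <= S.
Proof. intros HG S0 HS. apply le_of_sqr_le; [lra|]. rewrite HS. nra. Qed.

(** Gives [(A + N1) / 2 <= (S + 2 N1) / 3]. The difference of squares is
    [(A - G) (7 A + 17 G)]. *)
Lemma rootsq_ge_linear A G S : 0 < G <= A -> 0 <= S ->
  S ^ 2 = 2 * A ^ 2 - G ^ 2 -> 5 * A - G <= 4 * S.
Proof.
  intros HG S0 HS. apply le_of_sqr_le; [lra|].
  assert (0 <= (A - G) * (7 * A + 17 * G)) by (apply Rmult_le_pos; lra).
  nra.
Qed.

(** * Bounds involving the harmonic mean *)

(** Gives [G <= (S + 2 H) / 3]. *)
Lemma rootsq_ge_of_harm_geom A G S : 0 < G <= A -> 0 <= S ->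
  S ^ 2 = 2 * A ^ 2 - G ^ 2 -> 3 * A * G - 2 * G ^ 2 <= A * S.
Proof.
  intros HG S0 HS. apply le_of_sqr_le; [nra|].
  replace ((A * S) ^ 2) with (A ^ 2 * S ^ 2) by ring. rewrite HS.
  assert (0 <= (A - G) ^ 2 * (A ^ 2 + 2 * G * (A - G)))
    by (apply Rmult_le_pos; nra).
  nra.
Qed.

(** Gives [(S + 2 H) / 3 <= N1]. *)
Lemma rootsq_le_of_harm A G S : 0 < G <= A -> S ^ 2 = 2 * A ^ 2 - G ^ 2 ->
  2 * (A * S) <= 3 * A ^ 2 + 3 * A * G - 4 * G ^ 2.
Proof.
  intros HG HS. apply le_of_sqr_le; [nra|].
  replace ((2 * (A * S)) ^ 2) with (4 * A ^ 2 * S ^ 2) by ring. rewrite HS.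
  (* The cofactor is [A ^ 3 + 19 A ^ 2 G + 8 A G ^ 2 - 16 G ^ 3], grouped
     here so that each term is nonnegative when [G <= A]. *)
  assert (C : 0 <= A ^ 3 + 3 * A ^ 2 * G + 8 * A * G ^ 2
                   + 16 * G * (A ^ 2 - G ^ 2)).
  { assert (0 <= A ^ 3) by (apply pow_le; lra).
    assert (0 <= A ^ 2 * G) by (apply Rmult_le_pos; nra).
    assert (0 <= A * G ^ 2) by (apply Rmult_le_pos; nra).
    assert (0 <= G * (A ^ 2 - G ^ 2)) by (apply Rmult_le_pos; nra).
    lra. }
  assert (0 <= (A - G) * (A ^ 3 + 3 * A ^ 2 * G + 8 * A * G ^ 2
                          + 16 * G * (A ^ 2 - G ^ 2)))
    by (apply Rmult_le_pos; lra).
  lra.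
Qed.

(** Gives [N1 <= (S + H) / 2]. The difference of squares is
    [(A - G) ^ 3 (A + G)]. *)
Lemma rootsq_ge_of_harm A G S : 0 < G <= A -> 0 <= S ->
  S ^ 2 = 2 * A ^ 2 - G ^ 2 -> A ^ 2 + A * G - G ^ 2 <= A * S.
Proof.
  intros HG S0 HS. apply le_of_sqr_le; [nra|].
  replace ((A * S) ^ 2) with (A ^ 2 * S ^ 2) by ring. rewrite HS.
  assert (0 <= (A - G) ^ 3 * (A + G))
    by (apply Rmult_le_pos; [apply pow_le|]; lra).
  lra.
Qed.

(** * Bounds involving N2 *)

(** The lower bound is [N3 <= N2] and the upper one is [N2 <= (A + N1) / 2]. *)
Lemma N2_bounds A G U : 0 < G <= A -> 0 <= U ->
  2 * U ^ 2 = A * (A + G) -> (2 * A + G) / 3 <= U <= (3 * A + G) / 4.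
Proof.
  intros HG U0 HU. split; apply le_of_sqr_le; try lra; nra.
Qed.

(** With [G] eliminated, the two bounds on [S] that mention only [A] and
    [U = N2] square to polynomial inequalities in these two variables, which
    then factor through [(A - U) ^ 2]. *)
Lemma rootsq_sqr_of_N2 A G S U : S ^ 2 = 2 * A ^ 2 - G ^ 2 ->
  2 * U ^ 2 = A * (A + G) ->
  (A * S) ^ 2 = A ^ 4 + 4 * A ^ 2 * U ^ 2 - 4 * U ^ 4.
Proof.
  intros HS HU.
  replace ((A * S) ^ 2) with (2 * A ^ 4 - (A * G) ^ 2)
    by (transitivity (A ^ 2 * S ^ 2); [rewrite HS|]; ring).
  replace (A * G) with (2 * U ^ 2 - A ^ 2) by (rewrite HU; ring).
  ring.
Qed.

(** Gives [(S + 2 N1) / 3 <= (S + 4 N2) / 5], since [A N1 = U ^ 2]. The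
    cofactor [29 U ^ 2 - 2 A U - A ^ 2] is nonnegative because
    [2 U ^ 2 >= A ^ 2]. *)
Lemma rootsq_le_of_N2_N1 A G S U : 0 < G <= A ->
  S ^ 2 = 2 * A ^ 2 - G ^ 2 -> 0 <= U -> 2 * U ^ 2 = A * (A + G) ->
  A * S <= 6 * A * U - 5 * U ^ 2.
Proof.
  intros HG HS U0 HU.
  destruct (N2_bounds A G U HG U0 HU) as [_ UA].
  apply le_of_sqr_le; [nra|].
  rewrite (rootsq_sqr_of_N2 A G S U HS HU).
  assert (0 <= (A - U) ^ 2 * (29 * U ^ 2 - 2 * A * U - A ^ 2))
    by (apply Rmult_le_pos; nra).
  lra.
Qed.

(** Gives [(S + 4 N2) / 5 <= A]. The squares of the two sides multiplied by
    [A] differ by [4 (A - U) ^ 2 (6 A ^ 2 + 2 A U + U ^ 2)]. *)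
Lemma rootsq_le_of_N2 A G S U : 0 < G <= A ->
  S ^ 2 = 2 * A ^ 2 - G ^ 2 -> 0 <= U -> 2 * U ^ 2 = A * (A + G) ->
  S <= 5 * A - 4 * U.
Proof.
  intros HG HS U0 HU.
  destruct (N2_bounds A G U HG U0 HU) as [_ UA].
  apply Rmult_le_reg_l with A; [lra|].
  apply le_of_sqr_le; [nra|].
  rewrite (rootsq_sqr_of_N2 A G S U HS HU).
  assert (0 <= (A - U) ^ 2 * (6 * A ^ 2 + 2 * A * U + U ^ 2))
    by (apply Rmult_le_pos; nra).
  lra.
Qed.

(** Gives [(S + H) / 2 <= N2]. The difference of squares is
    [G (2 A ^ 3 + A ^ 2 G + G ^ 3 - 4 A G U)]; replacing [U] by its upper bound
    [A] leaves [G (A - G) ^ 2 (2 A + G)]. The factor [G] reflects that the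
    inequality becomes an equality as [G / A] tends to 0. *)
Lemma rootsq_le_of_N2_harm A G S U : 0 < G <= A ->
  S ^ 2 = 2 * A ^ 2 - G ^ 2 -> 0 <= U -> 2 * U ^ 2 = A * (A + G) ->
  A * S <= 2 * A * U - G ^ 2.
Proof.
  intros HG HS U0 HU.
  destruct (N2_bounds A G U HG U0 HU) as [LU UA].
  apply le_of_sqr_le; [nra|].
  assert (E : (2 * A * U - G ^ 2) ^ 2 - (A * S) ^ 2
              = G * ((A - G) ^ 2 * (2 * A + G)) + 4 * A * G ^ 2 * (A - U)).
  { transitivity (2 * A ^ 2 * (2 * U ^ 2) - 4 * A * U * G ^ 2 + G ^ 4
                  - A ^ 2 * S ^ 2); [ring|].
    rewrite HU, HS. ring. }
  assert (0 <= G * ((A - G) ^ 2 * (2 * A + G)))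
    by (apply Rmult_le_pos; [|apply Rmult_le_pos]; nra).
  assert (0 <= 4 * A * G ^ 2 * (A - U))
    by (apply Rmult_le_pos; [apply Rmult_le_pos|]; nra).
  lra.
Qed.

(** * The means as functions of A and G *)

Lemma meanG_bounds a b : 0 < a -> 0 < b -> 0 < meanG a b <= meanA a b.
Proof.
  intros Ha Hb. unfold meanG, meanA. split.
  - apply sqrt_lt_R0, Rmult_lt_0_compat; assumption.
  - apply le_of_sqr_le; [lra|].
    rewrite pow2_sqrt by (apply Rlt_le, Rmult_lt_0_compat; assumption).
    pose proof (pow2_ge_0 (a - b)). lra.
Qed.

Lemma meanN1_eq a b : 0 < a -> 0 < b ->
  meanN1 a b = (meanA a b + meanG a b) / 2.
Proof.
  intros Ha Hb. unfold meanN1, meanA, meanG.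
  rewrite sqrt_mult by lra.
  assert (Ea : sqrt a ^ 2 = a) by (apply pow2_sqrt; lra).
  assert (Eb : sqrt b ^ 2 = b) by (apply pow2_sqrt; lra).
  nra.
Qed.

Lemma meanN3_eq a b : meanN3 a b = (2 * meanA a b + meanG a b) / 3.
Proof. unfold meanN3, meanA, meanG. field. Qed.

Lemma meanS_sqr a b : 0 < a -> 0 < b ->
  meanS a b ^ 2 = 2 * meanA a b ^ 2 - meanG a b ^ 2.
Proof.
  intros Ha Hb. unfold meanS, meanA, meanG.
  pose proof (Rmult_lt_0_compat a b Ha Hb).
  pose proof (pow2_ge_0 a). pose proof (pow2_ge_0 b).
  rewrite !pow2_sqrt by lra. field.
Qed.

Lemma meanH_mul a b : 0 < a -> 0 < b ->
  meanA a b * meanH a b = meanG a b ^ 2.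
Proof.
  intros Ha Hb. unfold meanA, meanH, meanG.
  rewrite pow2_sqrt by (apply Rlt_le, Rmult_lt_0_compat; assumption).
  field. lra.
Qed.

Lemma meanN2_sqr a b : 0 < a -> 0 < b ->
  2 * meanN2 a b ^ 2 = meanA a b * (meanA a b + meanG a b).
Proof.
  intros Ha Hb.
  replace (meanA a b + meanG a b) with (2 * meanN1 a b)
    by (rewrite meanN1_eq by assumption; field).
  unfold meanN2, meanN1, meanA.
  rewrite Rpow_mult_distr, (pow2_sqrt ((a + b) / 2)) by lra. ring.
Qed.

Lemma meanN2_nonneg a b : 0 <= meanN2 a b.
Proof.
  unfold meanN2. pose proof (sqrt_pos a). pose proof (sqrt_pos b).
  apply Rmult_le_pos; [lra | apply sqrt_pos].
Qed.

Theorem corollary3p4 : forall a b : R, 0 < a -> 0 < b ->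
  let H := meanH a b in
  let G := meanG a b in
  let N1 := meanN1 a b in
  let N2 := meanN2 a b in
  let N3 := meanN3 a b in
  let A := meanA a b in
  let S := meanS a b in
  (forall T : R, T = (S + 4 * N2) / 5 \/ T = (S + 3 * N3) / 4 ->
     G <= (S + 3 * G) / 4 /\
     (S + 3 * G) / 4 <= N1 /\
     N1 <= (S + 8 * N1) / 9 /\
     (S + 8 * N1) / 9 <= N3 /\
     N3 <= N2 /\
     N2 <= (A + N1) / 2 /\
     (A + N1) / 2 <= (S + 2 * N1) / 3 /\
     (S + 2 * N1) / 3 <= T /\
     T <= A) /\
  (G <= (S + 2 * H) / 3 /\
   (S + 2 * H) / 3 <= N1 /\
   N1 <= (S + H) / 2 /\
   (S + H) / 2 <= N2).
Proof.
  intros a b Ha Hb H G N1 N2 N3 A S.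
  pose proof (meanG_bounds a b Ha Hb) as HG.
  pose proof (meanN1_eq a b Ha Hb) as EN1.
  pose proof (meanN3_eq a b) as EN3.
  pose proof (meanS_sqr a b Ha Hb) as ES.
  pose proof (meanH_mul a b Ha Hb) as EH.
  pose proof (meanN2_sqr a b Ha Hb) as EN2.
  pose proof (meanN2_nonneg a b) as N2_0.
  assert (S0 : 0 <= meanS a b) by apply sqrt_pos.
  fold H in EH. fold G in HG, EN1, EN3, ES, EH, EN2. fold N1 in EN1.
  fold N2 in EN2, N2_0. fold N3 in EN3.
  fold A in HG, EN1, EN3, ES, EH, EN2. fold S in ES, S0.
  clearbody H G N1 N2 N3 A S.
  pose proof (rootsq_le A G S HG ES).
  pose proof (arith_le_rootsq A G S HG S0 ES).
  pose proof (N2_bounds A G N2 HG N2_0 EN2).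
  split.
  - intros T HT.
    pose proof (rootsq_ge_linear A G S HG S0 ES).
    pose proof (rootsq_le_of_N2 A G S N2 HG ES N2_0 EN2).
    assert (S + 5 * N1 <= 6 * N2).
    { pose proof (rootsq_le_of_N2_N1 A G S N2 HG ES N2_0 EN2).
      apply Rmult_le_reg_l with A; [lra|]. rewrite EN1. lra. }
    destruct HT; repeat split; lra.
  - pose proof (rootsq_ge_of_harm_geom A G S HG S0 ES).
    pose proof (rootsq_le_of_harm A G S HG ES).
    pose proof (rootsq_ge_of_harm A G S HG S0 ES).
    pose proof (rootsq_le_of_N2_harm A G S N2 HG ES N2_0 EN2).
    repeat split; apply Rmult_le_reg_l with A; nra.
Qed.
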